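(* Let $n\ge1$, $p\in[0,\infty]$, $q\in[0,1]$, and let $A\in\mathbb{C}^{n\times n}$. Let $X$ be the (unique) solution of the sparsification problem $$\min_{X\in\mathbb{C}^{n\times n}} J(X;A)\quad\text{such that}\quad \mathcal{N}(A)\subseteq\mathcal{N}(X),\quad \mathcal{N}(A^* )\subseteq\mathcal{N}(X^* ),\quad X_{ij}=0\text{ whenever }(\mathcal{Z}(A))_{ij}=0 .$$ If $A$ belongs to one of the following matrix subspaces: Hermitian, complex-symmetric, Hamiltonian, circulant, centrosymmetric, persymmetric, or one of the skew counterparts (skew-Hermitian, skew-complex-symmetric, skew-Hamiltonian, skew-circulant, skew-centrosymmetric, skew-persymmetric), then $X$ belongs to the same subspace.
   Context: Notation: $\mathcal{N}(\cdot)$ is the null-space, $^*$ the conjugate transpose, $^T$ the transpose, $^\dagger$ the Moore-Penrose pseudoinverse. The misfit is $J(X;A)=\tfrac12\|(X-A)A^\dagger\|_F^2+\tfrac12\|A^\dagger(X-A)\|_F^2$ (Frobenius norms). Matrix subspaces. Let $J=J_n$ be the $n\times n$ matrix with ones on the anti-diagonal and zeros elsewhere; for even $n$ let $K=\begin{bmatrix}0&I_{n/2}\\-I_{n/2}&0\end{bmatrix}$; let $C^{+}=\begin{bmatrix}0_{n-1}&I_{n-1}\\1&0_{n-1}^T\end{bmatrix}$ and $C^{-}=\begin{bmatrix}0_{n-1}&I_{n-1}\\-1&0_{n-1}^T\end{bmatrix}$, where $0_{n-1}$ is the zero column vector. $A$ is: Hermitian if $A-A^*=0$; skew-Hermitian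 if $A+A^*=0$; complex-symmetric if $A-A^T=0$; skew-complex-symmetric if $A+A^T=0$; Hamiltonian ($n$ even) if $KA+A^*K=0$; skew-Hamiltonian ($n$ even) if $KA-A^*K=0$; circulant if $AC^+-C^+A=0$; skew-circulant if $AC^--C^-A=0$; centrosymmetric if $AJ-JA=0$; skew-centrosymmetric if $AJ+JA=0$; persymmetric if $AJ-JA^*=0$; skew-persymmetric if $AJ+JA^*=0$. Sparsity pattern $\mathcal{Z}(A)=\mathcal{Z}(A;p,q)$. For a vector $x$ put $\|x\|_p=(\sum|x_i|^p)^{1/p}$ for $1\le p<\infty$, $\|x\|_\infty=\max|x_i|$, $\|x\|_p=\sum|x_i|^p$ for $0<p<1$, $\|x\|_0=$ number of nonzero entries; the empty vector has value $0$. Vector pattern: given $x\in\mathbb{C}^k$ and an integer $N\ge0$, if $x=0$ the pattern is $0$. Otherwise order indices so that $|x_{i_1}|\le\dots\le|x_{i_k}|$, let $z$ be the number of zero entries of $x$ and $N'=\min(N,\|x\|_0)$, and let $j$ be the largest integer in $\{z,\dots,k-N'\}$ with $\|(x_{i_1},\dots,x_{i_j})\|_p\le(1-q)\|x\|_p$. If $j=k$ the pattern is $0$; otherwise, with $\tau=|x_{i_{j+1}}|>0$, the pattern has entry $1$ at position $i$ if $|x_i|\ge\tau$ and $0$ otherwise (all entries tied in magnitude with the smallest preserved one are preserved). Matrix pattern: for $A\in\mathbb{C}^{m\times n}$ of rank $r$, apply the vector pattern to each row with $N=N_{row}=\min(n,n-r+1)$ and to each column with $N=N_{col}=\min(m,m-r+1)$;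 $(\mathcal{Z}(A))_{ij}=1$ if the row pattern or the column pattern (or both) has a $1$ at position $(i,j)$, and $0$ otherwise. *)

(* Defs.v *)
From mathcomp Require Import all_boot all_order all_algebra.
From mathcomp Require Import all_classical all_reals all_analysis.
From mathcomp Require Export complex.

Set Implicit Arguments.
Unset Strict Implicit.
Unset Printing Implicit Defensive.

Import Order.TTheory GRing.Theory Num.Theory.
Import ComplexField.Normc.

Local Open Scope ring_scope.
Local Open Scope complex_scope.
Local Open Scope sesquilinear_scope.

Section Misfit.
Context {R : realType}.

Definition frobenius_norm m n (A : 'M[R[i]]_(m, n)) : R :=
  Num.sqrt (\sum_i \sum_j normc (A i j) ^+ 2).

(* the four Penrose conditions *)
Definition is_pseudoinverse m n (A : 'M[R[i]]_(m, n)) (P : 'M[R[i]]_(n, m)) :=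
  [/\ A *m P *m A = A,
      P *m A *m P = P,
      (A *m P)^t* = A *m P &
      (P *m A)^t* = P *m A].

(* Every matrix has exactly one pseudoinverse, so the default value 0 of xget
   is never used for want of a candidate. *)
Definition pseudoinverse m n (A : 'M[R[i]]_(m, n)) : 'M[R[i]]_(n, m) :=
  xget 0 [set P | is_pseudoinverse A P]%classic.

Definition misfit m n (X A : 'M[R[i]]_(m, n)) : R :=
  2^-1 * frobenius_norm ((X - A) *m pseudoinverse A) ^+ 2 +
  2^-1 * frobenius_norm (pseudoinverse A *m (X - A)) ^+ 2.

Definition null_space_sub m1 m2 n (A : 'M[R[i]]_(m1, n)) (B : 'M[R[i]]_(m2, n)) :=
  forall v : 'cV[R[i]]_n, A *m v = 0 -> B *m v = 0.

End Misfit.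

Section SparsityPattern.
Context {R : realType}.

(* ||x||_p for p in [0, +oo], the vector x being given by the sequence of its
   entries; the exponent 1/p is used only for 1 <= p < +oo. The value -oo of p
   is irrelevant. *)
Definition lp_norm (p : \bar R) (s : seq R[i]) : R :=
  match p with
  | r%:E =>
      if r == 0 then (count (fun x => x != 0) s)%:R
      else if r < 1 then \sum_(x <- s) normc x `^ r
      else (\sum_(x <- s) normc x `^ r) `^ r^-1
  | +oo%E => \big[Num.max/0]_(x <- s) normc x
  | -oo%E => 0
  end.

Definition entries k (x : 'rV[R[i]]_k) : seq R[i] :=
  [seq x ord0 i | i <- enum 'I_k].

Definition sorted_entries k (x : 'rV[R[i]]_k) : seq R[i] :=
  sort (fun a b => normc a <= normc b) (entries x).

Definition num_zeros k (x : 'rV[R[i]]_k) : nat := #|[set i | x ord0 i == 0]|.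

Definition num_nonzeros k (x : 'rV[R[i]]_k) : nat := #|[set i | x ord0 i != 0]|.

(* The number of entries of smallest magnitude that may be dropped. The set
   over which the maximum is taken always contains z when 0 <= q <= 1. *)
Definition drop_count (p : \bar R) (q : R) (N : nat) k (x : 'rV[R[i]]_k) : nat :=
  let z := num_zeros x in
  let N' := minn N (num_nonzeros x) in
  \max_(j < k.+1 | (z <= j <= k - N')%N &&
      (lp_norm p (take j (sorted_entries x))
         <= (1 - q) * lp_norm p (entries x))) j.

Definition vector_pattern (p : \bar R) (q : R) (N : nat) k (x : 'rV[R[i]]_k) :
    'rV[bool]_k :=
  let j := drop_count p q N x in
  \row_i [&& x != 0, j != k
           & normc (nth 0 (sorted_entries x) j) <= normc (x ord0 i)].

Definition matrix_pattern (p : \bar R) (q : R) m n (A : 'M[R[i]]_(m, n)) :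
    'M[bool]_(m, n) :=
  let r := \rank A in
  let Nrow := minn n (n - r + 1) in
  let Ncol := minn m (m - r + 1) in
  \matrix_(i, j) (vector_pattern p q Nrow (row i A) ord0 j
                  || vector_pattern p q Ncol (col j A)^T ord0 i).

End SparsityPattern.

Section Sparsification.
Context {R : realType}.

Definition feasible (p : \bar R) (q : R) m n (A X : 'M[R[i]]_(m, n)) :=
  [/\ null_space_sub A X,
      null_space_sub (A^t*) (X^t*) &
      forall i j, matrix_pattern p q A i j = false -> X i j = 0].

Definition is_sparsification (p : \bar R) (q : R) m n
    (A X : 'M[R[i]]_(m, n)) :=
  feasible p q A X /\
  forall Y, feasible p q A Y -> misfit X A <= misfit Y A.

End Sparsification.

Section Subspaces.
Context {R : realType}.

Definition exchange_mx n : 'M[R[i]]_n := \matrix_(i, j) (i + j == n.-1)%N%:R.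

(* [0, I; -I, 0] with blocks of size n/2; meaningful for even n only *)
Definition symplectic_mx n : 'M[R[i]]_n :=
  \matrix_(i, j) ((j == i + n./2 :> nat)%N%:R - (i == j + n./2 :> nat)%N%:R).

(* [0, I_(n-1); c, 0]: this is C^+ for c = 1 and C^- for c = -1 *)
Definition shift_mx n (c : R[i]) : 'M[R[i]]_n :=
  \matrix_(i, j) if j == i.+1 :> nat then 1
                 else if (i == n.-1 :> nat) && (j == 0 :> nat) then c else 0.

Inductive matrix_subspace : Type :=
  | Hermitian | SkewHermitian
  | ComplexSymmetric | SkewComplexSymmetric
  | Hamiltonian | SkewHamiltonian
  | Circulant | SkewCirculant
  | Centrosymmetric | SkewCentrosymmetric
  | Persymmetric | SkewPersymmetric.

Definition in_subspace (S : matrix_subspace) n (A : 'M[R[i]]_n) : Prop :=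
  let J := exchange_mx n in
  let K := symplectic_mx n in
  match S with
  | Hermitian => A - A^t* = 0
  | SkewHermitian => A + A^t* = 0
  | ComplexSymmetric => A - A^T = 0
  | SkewComplexSymmetric => A + A^T = 0
  | Hamiltonian => ~~ odd n /\ K *m A + A^t* *m K = 0
  | SkewHamiltonian => ~~ odd n /\ K *m A - A^t* *m K = 0
  | Circulant => A *m shift_mx n 1 - shift_mx n 1 *m A = 0
  | SkewCirculant => A *m shift_mx n (-1) - shift_mx n (-1) *m A = 0
  | Centrosymmetric => A *m J - J *m A = 0
  | SkewCentrosymmetric => A *m J + J *m A = 0
  | Persymmetric => A *m J - J *m A^t* = 0
  | SkewPersymmetric => A *m J + J *m A^t* = 0
  end.

End Subspaces.

(* Main.v *)
Require Import Defs.
From mathcomp Require Import all_boot all_order all_algebra fingroup perm.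
From mathcomp Require Import all_classical all_reals all_analysis.
From mathcomp Require Import ring lra zify.

Set Implicit Arguments.
Unset Strict Implicit.
Unset Printing Implicit Defensive.

Import Order.TTheory GRing.Theory Num.Theory.
Import ComplexField.Normc.

Local Open Scope ring_scope.
Local Open Scope complex_scope.
Local Open Scope sesquilinear_scope.

(** Each of the twelve subspaces is the set of fixed points of a map
    phi B = +- U f(B) U^T, where U is a signed permutation matrix and f is the
    identity, the transpose or the conjugate transpose
    ([subspace_signed_symmetry]).  For the circulant classes U is the cyclic
    shift, for the centrosymmetric and persymmetric ones the exchange matrix,
    for the Hamiltonian ones the symplectic matrix, and otherwise the identity.

    Suppose phi A = A.  Then phi preserves the whole minimization problem.
    Since U is unitary, phi maps the pseudoinverse P of A to a pseudoinverse
    of phi A = A, hence to P; up to sign, phi either preserves or reverses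
    products, so the two terms of the misfit are preserved or exchanged
    ([misfit_signed_symmetry]).  The two null-space conditions on X amount to
    X P A = X and A P X = X ([feasibleE]), and these also are preserved or
    exchanged.  Finally, up to signs and conjugation phi only moves entries
    around, by one permutation s of both the rows and the columns, combined
    possibly with a transposition.  The sparsity pattern of a row or of a column
    depends only on the moduli of its entries, and it breaks no tie
    ([vector_pattern_perm]); so the pattern of A = phi A is invariant under the
    same movement ([matrix_pattern_perm]).

    Hence phi X is a minimizer whenever X is one, and phi X = X as soon as
    minimizers are unique.  Uniqueness is strict convexity: by the
    parallelogram identity, the midpoint of two minimizers X and Y would beat
    them unless (X - Y) P = 0, and then X - Y = (X - Y) P A = 0
    ([sparsification_unique]).  All of this relies on the existence of the
    pseudoinverse, which comes from a full-rank factorization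
    ([pseudoinverse_exists]). *)

(** * The sparsity pattern depends on moduli only *)

Section Pattern.
Context {R : realType}.
Implicit Types (p : \bar R) (q : R).

Lemma normc_eq0 (x : R[i]) : (normc x == 0) = (x == 0).
Proof. by apply/eqP/eqP => [/eq0_normc|->] //; rewrite normc0. Qed.

(** The exponent 0 counts nonzero entries, and an entry is nonzero exactly when
    its modulus is; so the moduli determine the norm for this exponent too. *)
Lemma lp_norm_perm p (s t : seq R[i]) :
  perm_eq [seq normc x | x <- s] [seq normc x | x <- t] ->
  lp_norm p s = lp_norm p t.
Proof.
case: p => [r||] //= st.
  have sumE v : \sum_(x <- v) normc x `^ r =
      \sum_(a <- [seq normc x | x <- v]) a `^ r :> R by rewrite big_map.
  have countE v : count (fun x : R[i] => x != 0) v =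
      count (fun a : R => a != 0) [seq normc x | x <- v].
    by rewrite count_map; apply: eq_count => x /=; rewrite normc_eq0.
  by rewrite !countE !sumE (seq.permP st) (perm_big _ st).
have maxE v : \big[Num.max/0]_(x <- v) normc x =
    \big[Num.max/0]_(a <- [seq normc x | x <- v]) a :> R by rewrite big_map.
by rewrite !maxE; exact: perm_big.
Qed.

Lemma card_perm_eq k (s : 'S_k) (P Q : pred 'I_k) :
  (forall i, P i = Q (s i)) -> #|[set i | P i]| = #|[set i | Q i]|.
Proof.
move=> PQ; rewrite -(card_imset [set i | P i] (@perm_inj _ s)).
congr #|pred_of_set _|; apply/setP => j; rewrite inE; apply/imsetP/idP.
  by move=> [l]; rewrite inE PQ => Ql ->.
by move=> Qj; exists ((s^-1)%g j); rewrite ?inE ?PQ permKV.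
Qed.

Lemma entries_perm k (s : 'S_k) (x y : 'rV[R[i]]_k) :
  (forall i, normc (y ord0 i) = normc (x ord0 (s i))) ->
  perm_eq [seq normc a | a <- entries y] [seq normc a | a <- entries x].
Proof.
move=> yx; have -> : [seq normc a | a <- entries y] =
    [seq normc a | a <- [seq x ord0 i | i <- [seq s i | i <- enum 'I_k]]].
  by rewrite -!map_comp; apply: eq_map.
apply/perm_map/perm_map/uniq_perm; rewrite ?enum_uniq //.
  by rewrite map_inj_uniq ?enum_uniq //; exact: perm_inj.
move=> i; rewrite mem_enum inE; apply/mapP; exists ((s^-1)%g i).
  by rewrite mem_enum.
by rewrite permKV.
Qed.

Lemma map_sorted_entries k (x : 'rV[R[i]]_k) :
  [seq normc a | a <- sorted_entries x] =
  sort <=%O [seq normc a | a <- entries x].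
Proof. by rewrite [RHS]sort_map. Qed.

(** Sorting may order entries of equal modulus differently in x and in y, but
    the sorted lists of moduli agree, and everything in the pattern (number of
    dropped entries, threshold, comparison with the threshold) is read off the
    moduli. *)
Lemma vector_pattern_perm p q N k (s : 'S_k) (x y : 'rV[R[i]]_k) i :
  (forall i, normc (y ord0 i) = normc (x ord0 (s i))) ->
  vector_pattern p q N y ord0 i = vector_pattern p q N x ord0 (s i).
Proof.
move=> yx; have yx_perm := entries_perm yx.
have sortE : [seq normc a | a <- sorted_entries y] =
    [seq normc a | a <- sorted_entries x].
  by rewrite !map_sorted_entries; exact/perm_sort_leP.
have zE j : (y ord0 j == 0) = (x ord0 (s j) == 0).
  by rewrite -!normc_eq0 yx.
have dropE : drop_count p q N y = drop_count p q N x.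
  have zerosE : num_zeros y = num_zeros x by exact: (@card_perm_eq _ s).
  have nonzerosE : num_nonzeros y = num_nonzeros x.
    by apply: (@card_perm_eq _ s) => j; rewrite zE.
  rewrite /drop_count zerosE nonzerosE.
  apply: eq_bigl => j; rewrite (lp_norm_perm p yx_perm).
  by rewrite (@lp_norm_perm p _ (take j (sorted_entries x))) // !map_take sortE.
rewrite !mxE dropE yx; congr [&& ~~ _, _ & _].
  apply/eqP/eqP => [y0|x0]; apply/rowP => j; rewrite !mxE; apply/eqP.
    by rewrite -(permKV s j) -zE y0 mxE.
  by rewrite zE x0 mxE.
(* Both sides are 0 past the end of the list, the default 0 having modulus 0. *)
have nthE (z : 'rV[R[i]]_k) j : normc (nth 0 (sorted_entries z) j) =
    nth 0 [seq normc a | a <- sorted_entries z] j.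
  have [lt_j|le_j] := ltnP j (size (sorted_entries z)).
    by rewrite (nth_map 0).
  by rewrite !nth_default ?size_map // normc0.
by rewrite !nthE sortE.
Qed.

(** When t holds, the symmetry exchanges rows and columns; the row and column
    patterns then trade places because A is square. *)
Lemma matrix_pattern_perm p q n (s : 'S_n) (t : bool) (A : 'M[R[i]]_n) i j :
  (forall i j, normc (A i j) =
     normc (if t then A (s j) (s i) else A (s i) (s j))) ->
  matrix_pattern p q A i j =
  if t then matrix_pattern p q A (s j) (s i)
  else matrix_pattern p q A (s i) (s j).
Proof.
case: t => AE; rewrite [LHS]mxE [RHS]mxE; first rewrite orbC; congr (_ || _);
  by apply: vector_pattern_perm => l; rewrite !mxE AE.
Qed.

End Pattern.

(** * The Frobenius norm *)

Section Frobenius.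
Context {R : realType}.

Lemma frobenius_norm_sq m n (A : 'M[R[i]]_(m, n)) :
  frobenius_norm A ^+ 2 = \sum_i \sum_j normc (A i j) ^+ 2.
Proof.
by rewrite sqr_sqrtr //; do 2!(apply: sumr_ge0 => ? _); exact: sqr_ge0.
Qed.

Lemma frobenius_norm_eq0 m n (A : 'M[R[i]]_(m, n)) :
  frobenius_norm A ^+ 2 <= 0 -> A = 0.
Proof.
rewrite frobenius_norm_sq => le0; apply/matrixP => i j; rewrite mxE.
have ge0 i' : 0 <= \sum_j normc (A i' j) ^+ 2.
  by apply: sumr_ge0 => ? _; exact: sqr_ge0.
have /eqP : \sum_i \sum_j normc (A i j) ^+ 2 = 0.
  by apply: le_anti; rewrite le0 sumr_ge0.
rewrite psumr_eq0 // => /allP/(_ i); rewrite mem_index_enum => /(_ isT) /=.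
rewrite psumr_eq0 => [|? _]; last exact: sqr_ge0.
move=> /allP/(_ j); rewrite mem_index_enum => /(_ isT) /=.
by rewrite sqrf_eq0 => /eqP/eq0_normc.
Qed.

Lemma normc_parallelogram (x y : R[i]) :
  normc (x + y) ^+ 2 + normc (x - y) ^+ 2 =
  2 * (normc x ^+ 2 + normc y ^+ 2).
Proof.
case: x y => [a b] [c d] /=; rewrite !sqr_sqrtr ?addr_ge0 ?sqr_ge0 //.
by ring.
Qed.

Lemma frobenius_norm_parallelogram m n (A B : 'M[R[i]]_(m, n)) :
  frobenius_norm (A + B) ^+ 2 + frobenius_norm (A - B) ^+ 2 =
  2 * (frobenius_norm A ^+ 2 + frobenius_norm B ^+ 2).
Proof.
rewrite !frobenius_norm_sq -!big_split mulr_sumr; apply: eq_bigr => i _ /=.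
rewrite -!big_split mulr_sumr; apply: eq_bigr => j _ /=.
by rewrite !mxE normc_parallelogram.
Qed.

Lemma frobenius_normZ m n (a : R[i]) (A : 'M[R[i]]_(m, n)) :
  frobenius_norm (a *: A) ^+ 2 = normc a ^+ 2 * frobenius_norm A ^+ 2.
Proof.
rewrite !frobenius_norm_sq mulr_sumr; apply: eq_bigr => i _.
rewrite mulr_sumr; apply: eq_bigr => j _.
by rewrite mxE normcM exprMn.
Qed.

End Frobenius.

(** * Existence and uniqueness of the pseudoinverse *)

Section Pseudoinverse.
Context {R : realType}.

Lemma adjmxM m n l (A : 'M[R[i]]_(m, n)) (B : 'M[R[i]]_(n, l)) :
  (A *m B)^t* = B^t* *m A^t*.
Proof. by rewrite trmx_mul map_mxM. Qed.

Lemma adjmxE m n (A : 'M[R[i]]_(m, n)) i j : (A^t*) i j = Num.conj (A j i).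
Proof. by rewrite !mxE. Qed.

Lemma adjmxK m n (A : 'M[R[i]]_(m, n)) : A^t*^t* = A.
Proof. exact: trmxCK. Qed.

Lemma mulmx_adj_eq0 m n (A : 'M[R[i]]_(m, n)) : A *m A^t* = 0 -> A = 0.
Proof.
move=> A0; apply/matrixP => i j; rewrite mxE.
have /matrixP/(_ i i) := A0; rewrite !mxE.
have ge0 k : 0 <= A i k * (A^t*) k i by rewrite !mxE -normCK exprn_ge0.
move=> /eqP; rewrite psumr_eq0 // => /allP/(_ j).
rewrite mem_index_enum => /(_ isT) /=.
by rewrite !mxE -normCK sqrf_eq0 normr_eq0 => /eqP.
Qed.

Lemma gram_unitmx m n (B : 'M[R[i]]_(m, n)) :
  row_free B -> B *m B^t* \in unitmx.
Proof.
move=> freeB; rewrite -row_free_unit; apply: inj_row_free => v vBB0.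
apply: (row_free_inj freeB); rewrite mul0mx; apply: mulmx_adj_eq0.
by rewrite adjmxM mulmxA -(mulmxA v) vBB0 mul0mx.
Qed.

Lemma adjmx_inv n (H : 'M[R[i]]_n) : H^t* = H -> (invmx H)^t* = invmx H.
Proof. by move=> HE; rewrite trmx_inv map_invmx HE. Qed.

(** The full-rank formula B^* (B B^* )^-1 (C^* C)^-1 C^*; the two Gram matrices
    are invertible because B has independent rows and C independent columns. *)
Lemma pseudoinverse_factorization m r n
    (C : 'M[R[i]]_(m, r)) (B : 'M[R[i]]_(r, n)) :
  row_free C^T -> row_free B -> exists P, is_pseudoinverse (C *m B) P.
Proof.
move=> freeC freeB.
have uB : B *m B^t* \in unitmx by exact: gram_unitmx.
have uC : C^t* *m C \in unitmx.
  by rewrite -{2}(adjmxK C); apply: gram_unitmx; rewrite row_free_map.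
pose GB := invmx (B *m B^t*); pose GC := invmx (C^t* *m C).
have GBE : GB^t* = GB by apply: adjmx_inv; rewrite adjmxM adjmxK.
have GCE : GC^t* = GC by apply: adjmx_inv; rewrite adjmxM adjmxK.
pose P := B^t* *m GB *m GC *m C^t*.
have CBP : C *m B *m P = C *m GC *m C^t*.
  by rewrite /P !mulmxA -(mulmxA C B (B^t*)) (mulmxK uB).
have PCB : P *m (C *m B) = B^t* *m GB *m B.
  by rewrite /P !mulmxA -(mulmxA _ (C^t*) C) (mulmxKV uC).
exists P; split.
- by rewrite CBP !mulmxA -(mulmxA _ (C^t*) C) (mulmxKV uC).
- by rewrite -(mulmxA P) CBP /P !mulmxA -(mulmxA _ (C^t*) C) (mulmxKV uC).
- by rewrite CBP !adjmxM GCE adjmxK mulmxA.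
- by rewrite PCB !adjmxM GBE adjmxK mulmxA.
Qed.

Lemma pseudoinverse_exists m n (A : 'M[R[i]]_(m, n)) :
  exists P, is_pseudoinverse A P.
Proof.
rewrite -(mulmx_base A); apply: pseudoinverse_factorization.
  by rewrite /row_free mxrank_tr; exact: col_base_full.
exact: row_base_free.
Qed.

Lemma pseudoinverseP m n (A : 'M[R[i]]_(m, n)) :
  is_pseudoinverse A (pseudoinverse A).
Proof. exact: (xgetPex 0 (pseudoinverse_exists A)). Qed.

(** A P = (A Q A P)^* = (A P) (A Q) = A Q, both projections being self-adjoint;
    likewise P A = Q A, and P = P A P is determined by these two products. *)
Lemma pseudoinverse_unique m n (A : 'M[R[i]]_(m, n)) (P Q : 'M[R[i]]_(n, m)) :
  is_pseudoinverse A P -> is_pseudoinverse A Q -> P = Q.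
Proof.
move=> [P1 P2 P3 P4] [Q1 Q2 Q3 Q4].
have APQ : A *m P = A *m Q.
  by rewrite -P3 -{1}Q1 -mulmxA adjmxM P3 Q3 mulmxA P1.
have PQA : P *m A = Q *m A.
  by rewrite -P4 -{1}Q1 -!mulmxA mulmxA adjmxM P4 Q4 mulmxA -(mulmxA Q) -mulmxA
    mulmxA -mulmxA P1.
by rewrite -P2 PQA -mulmxA APQ mulmxA Q2.
Qed.

(** P A - 1 maps into the null space of A, and B kills this range exactly when
    it kills the null space. *)
Lemma null_space_subE m1 m2 n (A : 'M[R[i]]_(m1, n)) (B : 'M[R[i]]_(m2, n))
    (P : 'M[R[i]]_(n, m1)) :
  A *m P *m A = A -> null_space_sub A B <-> B *m P *m A = B.
Proof.
move=> APA; split=> [AB|<- v Av]; last by rewrite -mulmxA Av mulmx0.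
apply/eqP; rewrite -subr_eq0 -mulmxA -{2}(mulmx1 B) -mulmxBr; apply/eqP.
apply/matrixP => i j.
have /matrixP/(_ i ord0) : B *m ((P *m A - 1%:M) *m delta_mx j (@ord0 0)) = 0.
  by apply: AB; rewrite mulmxA mulmxBr mulmx1 mulmxA APA subrr mul0mx.
by rewrite mulmxA -colE !mxE.
Qed.

End Pseudoinverse.

(** * Feasibility and uniqueness of the sparsification *)

Section Uniqueness.
Context {R : realType}.
Variables (p : \bar R) (q : R).

(** This equational form makes both null-space conditions linear in X and
    compatible with product-preserving symmetries. *)
Lemma feasibleE m n (A X : 'M[R[i]]_(m, n)) (P := pseudoinverse A) :
  feasible p q A X <-> [/\ X *m P *m A = X, A *m P *m X = X &
    forall i j, matrix_pattern p q A i j = false -> X i j = 0].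
Proof.
have [AP _ _ _] := pseudoinverseP A.
have AP' : A^t* *m P^t* *m A^t* = A^t* by rewrite -!adjmxM mulmxA AP.
have adj_inj : injective (fun Y : 'M[R[i]]_(m, n) => Y^t*).
  by move=> Y Z /= YZ; rewrite -(adjmxK Y) YZ adjmxK.
have nullE := @null_space_subE _ _ _ _ _ (X^t*) _ AP'.
have adjE : X^t* *m P^t* *m A^t* = X^t* <-> A *m P *m X = X.
  by rewrite -!adjmxM mulmxA; split=> [/adj_inj|->].
have rightE := @null_space_subE _ _ _ _ _ X _ AP.
split=> -[].
  by move=> /rightE XPA /nullE/adjE APX Z.
by move=> XPA APX Z; split=> //; [exact/rightE|exact/nullE/adjE].
Qed.

Lemma feasible_midpoint m n (A X Y : 'M[R[i]]_(m, n)) :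
  feasible p q A X -> feasible p q A Y -> feasible p q A (2^-1 *: (X + Y)).
Proof.
move=> /feasibleE[X1 X2 X3] /feasibleE[Y1 Y2 Y3]; apply/feasibleE; split.
- by rewrite -!scalemxAl !mulmxDl X1 Y1.
- by rewrite -scalemxAr mulmxDr X2 Y2.
- by move=> i j Zij; rewrite !mxE X3 // Y3 // addr0 mulr0.
Qed.

Lemma frobenius_norm_midpoint m n (A B : 'M[R[i]]_(m, n)) :
  frobenius_norm (2^-1 *: (A + B)) ^+ 2 =
  2^-1 * (frobenius_norm A ^+ 2 + frobenius_norm B ^+ 2)
    - 4^-1 * frobenius_norm (A - B) ^+ 2.
Proof.
have half : normc (2^-1 : R[i]) ^+ 2 = 4^-1.
  rewrite normcV exprVn; congr _^-1.
  by rewrite -[2 : R[i]]/(Complex (1 + 1) (0 + 0)) /= sqr_sqrtr; [ring|nra].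
rewrite frobenius_normZ half; move: (frobenius_norm_parallelogram A B).
do 4 move: (frobenius_norm _ ^+ 2) => ?.
lra.
Qed.

Lemma misfit_midpoint m n (A X Y : 'M[R[i]]_(m, n)) (P := pseudoinverse A) :
  misfit (2^-1 *: (X + Y)) A = 2^-1 * (misfit X A + misfit Y A)
    - 8^-1 * (frobenius_norm ((X - Y) *m P) ^+ 2 +
              frobenius_norm (P *m (X - Y)) ^+ 2).
Proof.
rewrite /misfit -/P.
have -> : 2^-1 *: (X + Y) - A = 2^-1 *: ((X - A) + (Y - A)).
  by apply/matrixP => i j; rewrite !mxE; field.
have -> : X - Y = (X - A) - (Y - A) by rewrite opprB addrA subrK.
move: (X - A) (Y - A) => D E.
rewrite -scalemxAl -scalemxAr mulmxDl mulmxDr mulmxBl mulmxBr.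
rewrite !frobenius_norm_midpoint.
do 6 move: (frobenius_norm _ ^+ 2) => ?.
lra.
Qed.

(** The midpoint of two minimizers is feasible and its misfit falls below the
    minimum by a multiple of the squared norm of (X - Y) P, which therefore
    vanishes; on the feasible set X - Y = (X - Y) P A. *)
Lemma sparsification_unique m n (A X Y : 'M[R[i]]_(m, n)) :
  is_sparsification p q A X -> is_sparsification p q A Y -> X = Y.
Proof.
move=> [fX minX] [fY minY].
have gap (a b d1 d2 : R) : a <= b -> b <= a ->
    a <= 2^-1 * (a + b) - 8^-1 * (d1 + d2) -> 0 <= d2 -> d1 <= 0 by lra.
have D0 : (X - Y) *m pseudoinverse A = 0.
  have := minX _ (feasible_midpoint fX fY); rewrite misfit_midpoint => mid.
  apply/frobenius_norm_eq0/(gap _ _ _ _ (minX _ fY) (minY _ fX) mid).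
  exact: sqr_ge0.
have [/feasibleE[X1 _ _] /feasibleE[Y1 _ _]] := (fX, fY).
by apply/eqP; rewrite -subr_eq0 -X1 -Y1 -!mulmxBl D0 mul0mx.
Qed.

End Uniqueness.

(** * Signed permutation symmetries *)

Section Symmetry.
Context {R : realType}.

Definition signed_perm_mx n (s : 'S_n) (u : 'I_n -> bool) : 'M[R[i]]_n :=
  \matrix_(i, j) ((-1) ^+ u i *+ (j == s i)).

Lemma mul_signed_perm_mx m n (s : 'S_n) u (B : 'M[R[i]]_(n, m)) i j :
  (signed_perm_mx s u *m B) i j = (-1) ^+ u i * B (s i) j.
Proof.
rewrite mxE (bigD1 (s i)) //= big1 => [|k /negPf ks]; rewrite mxE.
  by rewrite eqxx addr0.
by rewrite ks mul0r.
Qed.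

Lemma mul_signed_perm_mx_tr m n (s : 'S_n) u (B : 'M[R[i]]_(m, n)) i j :
  (B *m (signed_perm_mx s u)^T) i j = (-1) ^+ u j * B i (s j).
Proof.
by rewrite -[B]trmxK -trmx_mul mxE mul_signed_perm_mx mxE trmxK.
Qed.

Lemma signed_perm_mx_unitary n (s : 'S_n) u :
  signed_perm_mx s u *m (signed_perm_mx s u)^T = 1%:M.
Proof.
apply/matrixP => i j; rewrite mul_signed_perm_mx !mxE (inj_eq perm_inj).
by case: eqVneq => [->|]; rewrite ?mulr0 // -signr_addb addbb.
Qed.

(** t transposes and k conjugates, so that all four combinations of the
    two operations are treated at once. *)
Definition twist (t k : bool) n (A : 'M[R[i]]_n) : 'M[R[i]]_n :=
  let B := if t then A^T else A in if k then map_mx Num.conj B else B.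

(** The conjugating matrix is real and orthogonal, so its transpose is both its
    inverse and its adjoint. *)
Definition signed_symmetry (e t k : bool) n (s : 'S_n) u (A : 'M[R[i]]_n) :=
  (-1) ^+ e *: (signed_perm_mx s u *m twist t k A *m (signed_perm_mx s u)^T).

Section Properties.
Variables (e t k : bool) (n : nat) (s : 'S_n) (u : 'I_n -> bool).
Local Notation phi := (signed_symmetry e t k s u).

Lemma signed_symmetryB A B : phi (A - B) = phi A - phi B.
Proof.
rewrite /signed_symmetry -scalerBr -mulmxBl -mulmxBr; congr (_ *: (_ *m _ *m _)).
by rewrite /twist; case: t k => -[]; rewrite ?linearB ?map_mxB.
Qed.

Lemma signed_symmetryE A i j :
  phi A i j = (-1) ^+ e * ((-1) ^+ u j * ((-1) ^+ u i * twist t k A (s i) (s j))).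
Proof. by rewrite mxE mul_signed_perm_mx_tr mul_signed_perm_mx. Qed.

Lemma signed_symmetry_adj A : phi (A^t*) = (phi A)^t*.
Proof.
apply/matrixP => i j; rewrite adjmxE 2!signed_symmetryE.
rewrite !rmorphM !rmorph_sign; congr (_ * _); rewrite mulrCA.
congr (_ * (_ * _)).
by rewrite /twist; case: t k => -[] /=; rewrite !mxE /= ?conjCK.
Qed.

(** The inner factors U^T U cancel, and one of the two outer signs remains:
    the map is multiplicative, or antimultiplicative, only up to this sign. *)
Lemma signed_symmetryM A B :
  phi A *m phi B = (-1) ^+ e *: phi (if t then B *m A else A *m B).
Proof.
rewrite /signed_symmetry -scalemxAl -scalemxAr; congr (_ *: (_ *: _)).
set U := signed_perm_mx s u.
have UTU : U^T *m U = 1%:M by apply/mulmx1C/signed_perm_mx_unitary.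
rewrite -!mulmxA (mulmxA U^T U) UTU mul1mx !mulmxA -(mulmxA U _ (twist t k B)).
congr (_ *m _ *m _).
by rewrite /twist; case: t k => -[]; rewrite ?trmx_mul ?map_mxM.
Qed.

(** In products of three factors the leftover signs cancel; this is why the
    Penrose identities and the conditions X P A = X and A P X = X carry over. *)
Lemma signed_symmetryMM A B C :
  phi A *m phi B *m phi C =
  phi (if t then C *m B *m A else A *m B *m C).
Proof.
rewrite signed_symmetryM -scalemxAl signed_symmetryM scalerA -signr_addb addbb.
by rewrite scale1r; case: t; rewrite ?mulmxA.
Qed.

Lemma normc_signed_symmetry A i j :
  normc (phi A i j) = normc (if t then A (s j) (s i) else A (s i) (s j)).
Proof.
rewrite signed_symmetryE.
have normc_sign (b : bool) : normc ((-1) ^+ b : R[i]) = 1.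
  by case: b; rewrite ?normcN normc1.
rewrite !normcM !normc_sign !mul1r /twist.
have normc_conj (x : R[i]) : normc (Num.conj x) = normc x.
  by case: x => a b /=; rewrite sqrrN.
by case: t k => -[] /=; rewrite ?mxE /= ?normc_conj.
Qed.

Lemma frobenius_norm_signed_symmetry A :
  frobenius_norm (phi A) ^+ 2 = frobenius_norm A ^+ 2.
Proof.
rewrite !frobenius_norm_sq [RHS](reindex_inj (@perm_inj _ s)) /=.
under [RHS]eq_bigr => i _ do rewrite (reindex_inj (@perm_inj _ s)) /=.
transitivity (\sum_i \sum_j
    normc (if t then A (s j) (s i) else A (s i) (s j)) ^+ 2).
  by do 2!(apply: eq_bigr => ? _); rewrite normc_signed_symmetry.
by case: t; first exact: exchange_big.
Qed.

Lemma is_pseudoinverse_signed_symmetry A P :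
  is_pseudoinverse A P -> is_pseudoinverse (phi A) (phi P).
Proof.
move=> [P1 P2 P3 P4].
have adjZ (B : 'M[R[i]]_n) : B^t* = B ->
    ((-1) ^+ e *: phi B)^t* = (-1) ^+ e *: phi B.
  move=> BE; rewrite -{2}BE signed_symmetry_adj.
  apply/matrixP => i j; rewrite adjmxE [in LHS]mxE [RHS]mxE adjmxE.
  by rewrite rmorphM rmorph_sign.
split.
- by rewrite signed_symmetryMM if_same P1.
- by rewrite signed_symmetryMM if_same P2.
- by rewrite signed_symmetryM; apply: adjZ; case: t.
- by rewrite signed_symmetryM; apply: adjZ; case: t.
Qed.

Lemma pseudoinverse_signed_symmetry A :
  phi A = A -> phi (pseudoinverse A) = pseudoinverse A.
Proof.
move=> phiA; apply: (@pseudoinverse_unique _ _ _ A); last exact: pseudoinverseP.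
by rewrite -{1}phiA; apply/is_pseudoinverse_signed_symmetry/pseudoinverseP.
Qed.

(** As the pseudoinverse is fixed too, the symmetry acts on X - A alone.  When
    it reverses products, the two terms of the misfit are exchanged. *)
Lemma misfit_signed_symmetry A X : phi A = A -> misfit (phi X) A = misfit X A.
Proof.
move=> phiA; rewrite /misfit.
have normM (B C : 'M[R[i]]_n) : frobenius_norm (phi B *m phi C) ^+ 2 =
    frobenius_norm (if t then C *m B else B *m C) ^+ 2.
  rewrite signed_symmetryM frobenius_normZ frobenius_norm_signed_symmetry.
  by case: e; rewrite ?normcN normc1 expr1n mul1r.
have -> : phi X - A = phi (X - A) by rewrite signed_symmetryB phiA.
move: (pseudoinverse A) (pseudoinverse_signed_symmetry phiA) => P phiP.
move: (X - A) => D.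
transitivity (2^-1 * frobenius_norm (if t then P *m D else D *m P) ^+ 2 +
              2^-1 * frobenius_norm (if t then D *m P else P *m D) ^+ 2).
  by congr (_ * _ + _ * _); rewrite -normM phiP.
by case: t => //; rewrite addrC.
Qed.

Lemma feasible_signed_symmetry (p : \bar R) (q : R) A X :
  phi A = A -> feasible p q A X -> feasible p q A (phi X).
Proof.
move=> phiA /feasibleE[XPA APX XZ]; apply/feasibleE.
move: (pseudoinverse A) (pseudoinverse_signed_symmetry phiA) XPA APX.
move=> P phiP XPA APX; split.
- have -> : phi X *m P *m A = phi X *m phi P *m phi A by rewrite phiP phiA.
  by rewrite signed_symmetryMM XPA APX if_same.
- have -> : A *m P *m phi X = phi A *m phi P *m phi X by rewrite phiP phiA.
  by rewrite signed_symmetryMM XPA APX if_same.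
move=> i j Zij; apply/eqP; rewrite -normc_eq0 normc_signed_symmetry normc_eq0.
have AE i' j' : normc (A i' j') =
    normc (if t then A (s j') (s i') else A (s i') (s j')).
  by rewrite -{1}phiA normc_signed_symmetry.
move: Zij; rewrite (matrix_pattern_perm p q i j AE).
by case: t => /XZ ->.
Qed.

(** The image of a minimizer is again a minimizer, hence equal to it by
    uniqueness. *)
Lemma sparsification_signed_symmetry (p : \bar R) (q : R) A X :
  phi A = A -> is_sparsification p q A X -> phi X = X.
Proof.
move=> phiA [fX minX]; apply: (@sparsification_unique _ p q _ _ A); last by split.
split; first exact: feasible_signed_symmetry.
by move=> Y /minX; rewrite misfit_signed_symmetry.
Qed.

(** Multiplying by U on the right turns the fixed-point equation into the
    (skew-)commutation form in which the subspaces are defined. *)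
Lemma signed_symmetry_fixedE A :
  phi A = A <->
  A *m signed_perm_mx s u = (-1) ^+ e *: (signed_perm_mx s u *m twist t k A).
Proof.
have UUT := signed_perm_mx_unitary s u; have UTU := mulmx1C UUT.
split=> [phiA|AU].
  by rewrite -{1}phiA /signed_symmetry -scalemxAl -(mulmxA (_ *m _)) UTU mulmx1.
by rewrite /signed_symmetry scalemxAl -AU -mulmxA UUT mulmx1.
Qed.

End Properties.

End Symmetry.

(** * The matrix subspaces as fixed-point sets *)

Section Subspaces.
Context {R : realType}.

Lemma exchange_signed_perm n :
  @exchange_mx R n = signed_perm_mx (perm (@rev_ord_inj n)) (fun=> false).
Proof.
apply/matrixP => i j; rewrite !mxE permE expr0; congr (_ *+ nat_of_bool _).
by rewrite -val_eqE /=; have := ltn_ord i; have := ltn_ord j; lia.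
Qed.

Lemma shift_signed_perm n (b : bool) :
  @shift_mx R n ((-1) ^+ b) =
  signed_perm_mx (perm (@ordS_inj n)) (fun i => b && (i == n.-1 :> nat)).
Proof.
case: n => [|n]; first by apply/matrixP => -[].
apply/matrixP => i j; rewrite !mxE permE -val_eqE /=.
have [i_last|i_lt] := eqVneq (i : nat) n.
  rewrite i_last modnn andbT /= ltn_eqF //.
  by case: (j == 0 :> nat).
have lt_in : (i < n)%N by rewrite ltn_neqAle i_lt -ltnS ltn_ord.
rewrite andbF expr0 modn_small //.
by case: eqP.
Qed.

Lemma even_half_addK n : ~~ odd n -> (n./2 + n./2)%N = n.
Proof. by rewrite addnn; exact: even_halfK. Qed.

(** Translation by half the period on indices modulo an even number, which is
    the permutation underlying the symplectic matrix. *)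
Definition half_turn n (i : 'I_n.+1) : 'I_n.+1 :=
  inord (if (i < n.+1./2)%N then i + n.+1./2 else i - n.+1./2)%N.

Lemma half_turn_val n (i : 'I_n.+1) : ~~ odd n.+1 ->
  half_turn i = (if (i < n.+1./2)%N then i + n.+1./2 else i - n.+1./2)%N :> nat.
Proof.
move=> /even_half_addK half_n; rewrite inordK //; have := ltn_ord i.
by move: half_n; move: (n.+1./2) => h; case: (ltnP i h); lia.
Qed.

Lemma half_turn_inj n : ~~ odd n.+1 -> injective (@half_turn n).
Proof.
move=> even_n i j /(congr1 val); rewrite /= !half_turn_val // => ij.
apply: val_inj => /=; have := ltn_ord i; have := ltn_ord j.
move: ij (even_half_addK even_n); move: (n.+1./2) => h.
by case: (ltnP i h); case: (ltnP j h); lia.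
Qed.

Lemma symplectic_signed_perm n (even_n : ~~ odd n.+1) :
  @symplectic_mx R n.+1 =
  signed_perm_mx (perm (half_turn_inj even_n)) (fun i => n.+1./2 <= i)%N.
Proof.
apply/matrixP => i j; rewrite !mxE permE -val_eqE.
rewrite [val (half_turn i)]half_turn_val //.
have := ltn_ord i; have := ltn_ord j; have := even_half_addK even_n.
move: (n.+1./2) => h nE lt_j lt_i; case: (ltnP i h) => i_half.
  have -> : (i == j + h :> nat)%N = false by lia.
  by rewrite subr0 expr0.
have -> : (j == i + h :> nat)%N = false by lia.
have -> : (i == j + h :> nat)%N = (j == i - h :> nat)%N by lia.
by rewrite sub0r expr1 mulNrn.
Qed.

Lemma symplectic_sq n : ~~ odd n ->
  @symplectic_mx R n *m symplectic_mx n = - 1%:M.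
Proof.
case: n => [_|n even_n]; first by apply/matrixP => -[].
(* K is a signed permutation matrix and K^T = - K, so K K = - K K^T = - 1. *)
rewrite -{2}[symplectic_mx _]opprK.
have <- : (symplectic_mx n.+1)^T = - symplectic_mx n.+1 :> 'M[R[i]]_n.+1.
  by apply/matrixP => i j; rewrite !mxE opprB.
by rewrite mulmxN (symplectic_signed_perm even_n) signed_perm_mx_unitary.
Qed.

Lemma signed_perm_mx1 n : @signed_perm_mx R n 1%g (fun=> false) = 1%:M.
Proof.
by apply/matrixP => i j; rewrite !mxE perm1 expr0 eq_sym.
Qed.

Lemma eq_subr0 (V : zmodType) (a b : V) : a = b <-> a - b = 0.
Proof. by split=> [->|/eqP]; rewrite ?subrr // subr_eq0 => /eqP. Qed.

Lemma eq_addr0 (V : zmodType) (a b : V) : a = - b <-> a + b = 0.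
Proof. by rewrite eq_subr0 opprK. Qed.

(** The defining equations of the Hamiltonian classes have K on the left of X,
    the fixed-point equation has K on its right.  Multiplying by K on both sides
    passes from one to the other. *)
Lemma mulmx_sqN1_swap n (K X Y : 'M[R[i]]_n) : K *m K = - 1%:M ->
  X *m K + K *m Y = 0 -> K *m X + Y *m K = 0.
Proof.
move=> KK /(congr1 (fun Z => K *m Z *m K)).
rewrite mulmx0 mul0mx mulmxDr mulmxDl -!mulmxA KK mulmxN mulmx1 !mulmxA KK.
by rewrite mulNmx mul1mx mulmxN mulNmx -opprD => /eqP; rewrite oppr_eq0 => /eqP.
Qed.

(** In the Hamiltonian cases membership of A supplies the even size, which makes
    the symplectic matrix a signed permutation matrix; the symmetry found does
    not otherwise depend on A. *)
Lemma subspace_signed_symmetry (S : matrix_subspace) n (A : 'M[R[i]]_n) :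
  in_subspace S A ->
  exists e t k (s : 'S_n) u, forall X : 'M[R[i]]_n,
    signed_symmetry e t k s u X = X <-> in_subspace S X.
Proof.
have symplecticE (even_n : ~~ odd n) : exists (s : 'S_n) u,
    signed_perm_mx s u = symplectic_mx n :> 'M[R[i]]_n.
  case: n even_n {A} => [_|n even_n].
    by exists 1%g, (fun=> false); apply/matrixP => -[].
  by exists (perm (half_turn_inj even_n)), (fun i => n.+1./2 <= i)%N;
    rewrite symplectic_signed_perm.
have shiftE (b : bool) := @shift_signed_perm n b.
case: S => /=.
- move=> _; exists false, true, true, 1%g, (fun=> false) => X.
  rewrite signed_symmetry_fixedE signed_perm_mx1 mulmx1 mul1mx scale1r.
  exact: eq_subr0.
- move=> _; exists true, true, true, 1%g, (fun=> false) => X.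
  rewrite signed_symmetry_fixedE signed_perm_mx1 mulmx1 mul1mx scaleN1r.
  exact: eq_addr0.
- move=> _; exists false, true, false, 1%g, (fun=> false) => X.
  rewrite signed_symmetry_fixedE signed_perm_mx1 mulmx1 mul1mx scale1r.
  exact: eq_subr0.
- move=> _; exists true, true, false, 1%g, (fun=> false) => X.
  rewrite signed_symmetry_fixedE signed_perm_mx1 mulmx1 mul1mx scaleN1r.
  exact: eq_addr0.
- move=> [even_n _]; have [s [u KE]] := symplecticE even_n.
  have KK := symplectic_sq even_n.
  exists true, true, true, s, u => X.
  rewrite signed_symmetry_fixedE KE scaleN1r eq_addr0.
  split=> [/(mulmx_sqN1_swap KK)//|[_]].
  by rewrite addrC => /(mulmx_sqN1_swap KK); rewrite addrC.
- move=> [even_n _]; have [s [u KE]] := symplecticE even_n.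
  have KK := symplectic_sq even_n.
  exists false, true, true, s, u => X.
  rewrite signed_symmetry_fixedE KE scale1r eq_subr0 -mulmxN -mulNmx.
  split=> [/(mulmx_sqN1_swap KK)//|[_]].
  by rewrite addrC => /(mulmx_sqN1_swap KK); rewrite addrC.
- move=> _; exists false, false, false, (perm (@ordS_inj n)),
    (fun i => false && (i == n.-1 :> nat)) => X.
  rewrite signed_symmetry_fixedE -shiftE expr0 scale1r; exact: eq_subr0.
- move=> _; exists false, false, false, (perm (@ordS_inj n)),
    (fun i => true && (i == n.-1 :> nat)) => X.
  rewrite signed_symmetry_fixedE -shiftE expr1 scale1r; exact: eq_subr0.
- move=> _; exists false, false, false, (perm (@rev_ord_inj n)), (fun=> false).
  move=> X; rewrite signed_symmetry_fixedE -exchange_signed_perm scale1r.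
  exact: eq_subr0.
- move=> _; exists true, false, false, (perm (@rev_ord_inj n)), (fun=> false).
  move=> X; rewrite signed_symmetry_fixedE -exchange_signed_perm scaleN1r.
  exact: eq_addr0.
- move=> _; exists false, true, true, (perm (@rev_ord_inj n)), (fun=> false).
  move=> X; rewrite signed_symmetry_fixedE -exchange_signed_perm scale1r.
  exact: eq_subr0.
- move=> _; exists true, true, true, (perm (@rev_ord_inj n)), (fun=> false).
  move=> X; rewrite signed_symmetry_fixedE -exchange_signed_perm scaleN1r.
  exact: eq_addr0.
Qed.

End Subspaces.

Theorem theorem5p9 (R : realType) (n : nat) (p : \bar R) (q : R)
    (A X : 'M[R[i]]_n) (S : matrix_subspace) :
  (1 <= n)%N -> (0 <= p)%E -> 0 <= q <= 1 ->
  is_sparsification p q A X ->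
  in_subspace S A -> in_subspace S X.
Proof.
move=> _ _ _ minX SA.
have [e [t [k [s [u symE]]]]] := subspace_signed_symmetry SA.
apply/symE; apply: sparsification_signed_symmetry minX.
exact/symE.
Qed.
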